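(* If a separable Banach space has property HC$_\infty$, then it is asymptotic-$c_0$.
   Context: $[\mathbb N]^k$ is the set of $\bar n=(n_1<\dots<n_k)$ in $\mathbb N$, with Hamming distance $d_{\mathbb H}(\bar n,\bar m)=|\{j:n_j\ne m_j\}|$. A metric space $(M,d)$ has property HC$_\infty$ if there is $\lambda>0$ such that for every $k\in\mathbb N$ and every Lipschitz $f:([\mathbb N]^k,d_{\mathbb H})\to M$ there are $\bar n,\bar m\in[\mathbb N]^k$ with $\bar n\cap\bar m=\varnothing$ (as sets) and $d(f(\bar n),f(\bar m))\le\lambda\,\mathrm{Lip}(f)$. A Banach space $X$ is $C$-asymptotically $c_0$ ($C\ge1$) if for every $k\in\mathbb N$: there is a closed finite-codimensional subspace $X_1$ such that for all $x_1\in S_{X_1}$ there is a closed finite-codimensional $X_2$ such that for all $x_2\in S_{X_2}$ ... there is a closed finite-codimensional $X_k$ such that for all $x_k\in S_{X_k}$, $\|\sum_{i=1}^ka_ix_i\|\le C\max_i|a_i|$ for all $(a_i)\in\mathbb R^k$. $X$ is asymptotic-$c_0$ if it is $C$-asymptotically $c_0$ for some $C\ge1$. *)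

(* Defs.v *)
From HB Require Import structures.
From mathcomp Require Import all_boot all_order all_algebra.
From mathcomp Require Import all_classical all_reals all_analysis.
Set Implicit Arguments. Unset Strict Implicit. Unset Printing Implicit Defensive.
Import Order.TTheory GRing.Theory Num.Theory.
Import numFieldNormedType.Exports.
Local Open Scope classical_set_scope.
Local Open Scope ring_scope.

Section Defs.
Context {R : realType} {X : normedModType R}.

Definition incr_tuple (k : nat) (n : k.-tuple nat) : bool := sorted ltn n.

Definition hamming (k : nat) (n m : k.-tuple nat) : nat :=
  #|[set j : 'I_k | tnth n j != tnth m j]|.

Definition tuple_disjoint (k : nat) (n m : k.-tuple nat) : Prop :=
  forall i j : 'I_k, tnth n i != tnth m j.

Definition lip_const (k : nat) (f : k.-tuple nat -> X) (L : R) : Prop :=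
  0 <= L /\ forall n m, incr_tuple n -> incr_tuple m ->
    `|f n - f m| <= L * (hamming n m)%:R.

(* L = Lip(f), the least Lipschitz constant (f is Lipschitz iff it exists) *)
Definition is_Lip (k : nat) (f : k.-tuple nat -> X) (L : R) : Prop :=
  lip_const f L /\ forall L', lip_const f L' -> L <= L'.

Definition HC_infty : Prop :=
  exists lam : R, 0 < lam /\
    forall (k : nat) (f : k.-tuple nat -> X) (L : R), is_Lip f L ->
      exists n m, [/\ incr_tuple n, incr_tuple m, tuple_disjoint n m &
                      `|f n - f m| <= lam * L].

Definition lin_subspace (Y : set X) : Prop :=
  Y 0 /\ (forall x y, Y x -> Y y -> Y (x + y)) /\
  (forall (a : R) x, Y x -> Y (a *: x)).

Definition fin_codim (Y : set X) : Prop :=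
  exists s : seq X, forall x : X, exists (y : X) (a : 'I_(size s) -> R),
    Y y /\ x = y + \sum_(i < size s) a i *: s`_i.

Definition closed_fincodim_subspace (Y : set X) : Prop :=
  [/\ lin_subspace Y, closed Y & fin_codim Y].

Fixpoint asym_c0_game (C : R) (n : nat) (xs : seq X) : Prop :=
  match n with
  | 0 => forall a : 'I_(size xs) -> R,
           `|\sum_(i < size xs) a i *: xs`_i|
             <= C * \big[Num.max/0]_(i < size xs) `|a i|
  | n'.+1 => exists Y : set X, closed_fincodim_subspace Y /\
           forall x : X, Y x -> `|x| = 1 -> asym_c0_game C n' (rcons xs x)
  end.

Definition C_asymptotically_c0 (C : R) : Prop :=
  1 <= C /\ forall k : nat, asym_c0_game C k [::].

Definition asymptotic_c0 : Prop := exists C : R, C_asymptotically_c0 C.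

End Defs.

Definition separable (T : topologicalType) : Prop :=
  exists D : set T, countable D /\ dense D.

(* Main.v *)
Require Import Defs.
From HB Require Import structures.
From mathcomp Require Import all_boot all_order all_algebra.
From mathcomp Require Import all_classical all_reals all_analysis.
From mathcomp Require Import zify ring lra.
Set Implicit Arguments.
Unset Strict Implicit.
Unset Printing Implicit Defensive.
Import Order.TTheory GRing.Theory Num.Theory.
Import numFieldNormedType.Exports.
Local Open Scope classical_set_scope.
Local Open Scope ring_scope.

(** If the first player loses the game of length [k] for some bound, the second
    player's strategy gives a tree of ultrafilters on [X] that contain the
    kernel of every functional. In a sequence chosen generically along such
    ultrafilters, a functional norming the sum of a branch is almost zero on the
    terms off the branch; it arises as an iterated limit of norming functionals
    along the tree, so that it is also small on the terms chosen before the
    branch is completed. Hence adding signed terms off a branch of large sum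
    keeps the norm large. Applied to [n |-> sum_j z_{n_j}] with finitely many
    ultrafilters repeated periodically, the concentration property bounds sums
    of terms chosen along any finite list of such ultrafilters. Replacing the
    terms by such sums over whole levels of a tree in which every node has
    children of the same kind on all later levels, it then bounds the sums along
    branches of length [k] independently of [k]. Intersecting the subspaces
    played for all sign patterns gives the bound for all coefficients. *)

(** * Norming functionals by a Hahn-Banach argument *)

Section HahnBanach.
Context {R : realType} {X : normedModType R}.
Implicit Types (q : X -> R) (x y z : X).

Definition sublinear q :=
  (forall x y, q (x + y) <= q x + q y) /\
  (forall t x, 0 < t -> q (t *: x) <= t * q x).

Definition contraction (phi : X -> R) :=
  (forall a x y, phi (a *: x + y) = a * phi x + phi y) /\
  (forall x, `|phi x| <= `|x|).

Lemma sublinear0 q : sublinear q -> q 0 = 0.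
Proof.
move=> [qD qZ]; have := qD 0 0; have := qZ (2^-1) 0; rewrite scaler0 addr0.
have h : 0 < (2^-1 : R) by lra.
by move=> /(_ h); lra.
Qed.

Lemma sublinearZ q t x : sublinear q -> 0 <= t -> q (t *: x) = t * q x.
Proof.
move=> sq; rewrite le_eqVlt => /predU1P[<-|t0].
  by rewrite scale0r mul0r (sublinear0 sq).
apply/eqP; rewrite eq_le sq.2//= -ler_pdivlMl//.
by rewrite -{1}[x](scalerK (lt0r_neq0 t0)) sq.2// invr_gt0.
Qed.

Lemma sublinear_norm : sublinear (fun x => `|x|).
Proof.
by split=> [x y|t x t0]; [exact: ler_normD|rewrite normrZ gtr0_norm].
Qed.

(* The largest sublinear functional below [q] with [shift (- y) = - q y]. *)
Definition shift q y z :=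
  inf [set q (z + t *: y) - t * q y | t in [set t : R | 0 <= t]].

Lemma shift_has_lbound q y z : sublinear q ->
  has_lbound [set q (z + t *: y) - t * q y | t in [set t : R | 0 <= t]].
Proof.
move=> sq; exists (- q (- z)) => _ [t /= t0 <-].
rewrite -(sublinearZ _ sq t0).
by have := sq.1 (z + t *: y) (- z); rewrite addrAC subrr add0r; lra.
Qed.

Lemma shift_nonempty q y z :
  [set q (z + t *: y) - t * q y | t in [set t : R | 0 <= t]] !=set0.
Proof. by exists (q (z + 0 *: y) - 0 * q y), 0 => /=. Qed.

Lemma shift_le q y z t : sublinear q -> 0 <= t ->
  shift q y z <= q (z + t *: y) - t * q y.
Proof. by move=> sq t0; apply: ge_inf; [exact: shift_has_lbound|exists t]. Qed.

Lemma shift_le0 q y z : sublinear q -> shift q y z <= q z.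
Proof.
by move=> sq; have := shift_le y z sq (lexx 0); rewrite scale0r addr0 mul0r subr0.
Qed.

Lemma shiftN q y : sublinear q -> shift q y (- y) <= - q y.
Proof.
move=> sq; have := shift_le y (- y) sq ler01.
by rewrite scale1r mul1r addNr (sublinear0 sq) sub0r.
Qed.

Lemma sublinear_shift q y : sublinear q -> sublinear (shift q y).
Proof.
move=> sq; split=> [x z|a x a0].
  rewrite -lerBlDr; apply: lb_le_inf; first exact: shift_nonempty.
  move=> _ [s /= s0 <-]; rewrite lerBlDr -lerBlDl.
  apply: lb_le_inf; first exact: shift_nonempty.
  move=> _ [t /= t0 <-]; rewrite lerBlDl.
  apply: le_trans (shift_le _ _ sq (addr_ge0 s0 t0)) _.
  have := sq.1 (x + s *: y) (z + t *: y).
  by rewrite addrACA -scalerDl; lra.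
rewrite -ler_pdivrMl//; apply: lb_le_inf; first exact: shift_nonempty.
move=> _ [s /= s0 <-]; rewrite ler_pdivrMl//.
apply: le_trans (shift_le _ _ sq (mulr_ge0 (ltW a0) s0)) _.
by rewrite -scalerA -scalerDr (sublinearZ _ sq (ltW a0)) mulrBr mulrA.
Qed.

(** Zorn's lemma for the reversed pointwise order. The infimum over a chain stays subadditive
    because the smaller of two members serves at both points, and [- p (- x)] bounds it below. *)
Lemma minimal_sublinear p : sublinear p ->
  exists q, [/\ sublinear q, forall x, q x <= p x &
    forall q', sublinear q' -> (forall x, q' x <= q x) -> q' = q].
Proof.
move=> sp; pose T := {q : X -> R | sublinear q /\ forall x, q x <= p x}.
pose mk q (h : sublinear q /\ forall x, q x <= p x) : T := exist _ q h.
pose le (a b : T) := `[< forall x, sval b x <= sval a x >].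
have [||||t tmax] := @Zorn T le.
- by move=> t; apply/asboolP.
- move=> r s t /asboolP rs /asboolP st; apply/asboolP => x.
  exact: le_trans (st x) (rs x).
- move=> [r pr] [s ps] /asboolP/= rs /asboolP/= sr.
  have e : r = s by apply/funext => x; apply/eqP; rewrite eq_le rs sr.
  by subst s; congr exist; exact: Prop_irrelevance.
- move=> A totA; have [[a0 Aa0]|/nonemptyPn A0] := pselect (A !=set0); last first.
    by exists (mk p (conj sp (fun x => lexx _))) => s; rewrite A0.
  pose E x := [set sval a x | a in A].
  have E0 x : E x !=set0 by exists (sval a0 x), a0.
  have lE x : has_lbound (E x).
    exists (- p (- x)) => _ [[a [sa ap]] _ <-] /=.
    by have := sa.1 x (- x); rewrite subrr (sublinear0 sa); have := ap (- x); lra.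
  have infE a x : A a -> inf (E x) <= sval a x.
    by move=> Aa; apply: ge_inf => //; exists a.
  suff P : sublinear (fun x => inf (E x)) /\ forall x, inf (E x) <= p x.
    by exists (mk _ P) => s As; apply/asboolP => x /=; exact: infE.
  split; last first.
    by move=> x; apply: le_trans (infE a0 x Aa0) _; exact: (svalP a0).2.
  split=> [x y|t x t0].
    rewrite -lerBlDr; apply: lb_le_inf => // _ [a Aa <-].
    rewrite lerBlDr -lerBlDl; apply: lb_le_inf => // _ [b Ab <-].
    rewrite lerBlDl.
    have [/asboolP ab|/asboolP ba] := totA _ _ Aa Ab.
      apply: le_trans (infE b _ Ab) _; apply: le_trans ((svalP b).1.1 _ _) _.
      by rewrite lerD2r.
    apply: le_trans (infE a _ Aa) _; apply: le_trans ((svalP a).1.1 _ _) _.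
    by rewrite lerD2l.
  rewrite -ler_pdivrMl//; apply: lb_le_inf => // _ [a Aa <-].
  rewrite ler_pdivrMl//; apply: le_trans (infE a _ Aa) _.
  exact: (svalP a).1.2.
exists (sval t); have [st tp] := svalP t; split => // q' sq' q't.
have q'p x : q' x <= p x by exact: le_trans (q't x) (tp x).
by have /(congr1 sval) := tmax (mk q' (conj sq' q'p)) (introT (asboolP _) q't).
Qed.

(** A minimal [q] equals [shift q y] for every [y], so it is odd, hence linear. Starting from
    [shift] of the norm along [x] instead of the norm itself forces [q (- x) <= - |x|]. *)
Lemma norming_functional x : exists phi, contraction phi /\ phi x = `|x|.
Proof.
have sn := sublinear_norm.
have [q [sq qs qmin]] := minimal_sublinear (sublinear_shift x sn).
have qn z : q z <= `|z| by apply: le_trans (qs z) (shift_le0 _ _ sn).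
have qN y : q (- y) = - q y.
  have e : shift q y = q.
    by apply: qmin; [exact: sublinear_shift|move=> z; exact: shift_le0].
  have := shiftN y sq; rewrite e => h.
  have := sq.1 y (- y); rewrite subrr (sublinear0 sq).
  by apply: contra_leP; lra.
have qD y z : q (y + z) = q y + q z.
  have := sq.1 y z; have := sq.1 (- y) (- z); rewrite -opprD !qN.
  by move=> h1 h2; apply/eqP; rewrite eq_le h2/=; lra.
exists q; split; [split=> [a y z|z]|].
- rewrite qD; congr (_ + _); have [a0|/ltW a0] := leP 0 a.
    exact: sublinearZ.
  rewrite -[a *: y]opprK -scaleNr qN sublinearZ ?oppr_ge0//.
  by rewrite mulNr opprK.
- by rewrite ler_norml qn andbT lerNl -qN -[leRHS]normrN qn.
- apply/eqP; rewrite eq_le qn/=.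
  have := qs (- x); rewrite qN => h.
  by have := shiftN x sn; lra.
Qed.

End HahnBanach.

(** * Limits of bounded functions along ultrafilters *)

Lemma ultra_fmap (T U : Type) (f : T -> U) (F : set_system T) :
  UltraFilter F -> UltraFilter (f @ F).
Proof.
move=> FU; split=> [|G GF sG]; first exact: fmap_proper_filter.
rewrite predeqE => A; split=> [GA|/sG//].
have [//|FnA] := in_ultra_setVsetC (f @^-1` A) FU.
have /filter_ex[x []] // : G (A `&` ~` A) by apply: filterI => //; exact: sG.
Qed.

Lemma ultra_bounded_cvg (R : realType) (T : Type) (F : set_system T)
    (u : T -> R) (r : R) :
  UltraFilter F -> (forall x, `|u x| <= r) -> cvg (u @ F).
Proof.
move=> FU ur; have := @segment_compact R (- r) r; rewrite compact_ultra.
move=> /(_ (u @ F) (ultra_fmap _ FU)) [|p [_ ?]]; last by apply/cvg_ex; exists p.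
apply: (@filterS _ F _ setT); last exact: filterT.
by move=> x _; rewrite /= in_itv/= -ler_norml.
Qed.

(** * Trees of ultrafilters and iterated limits of functionals *)

Section IteratedUltrafilters.
Context {R : realType} {X : normedModType R}.
Implicit Types (V W : seq X -> set_system X) (h b : seq X) (P : seq X -> Prop).

(** Containing every kernel is stronger than weak convergence to 0. Asking for the unit ball instead
    of the sphere admits the principal ultrafilter at 0. *)
Definition weakly_null (F : set_system X) :=
  [/\ UltraFilter F, F [set x | `|x| <= 1] &
      forall phi, contraction phi -> F [set x | phi x = 0]].

Fixpoint allU V n h P : Prop :=
  if n is n'.+1 then \forall x \near V h, allU V n' (rcons h x) P else P h.

Lemma sub_allU V n h P Q : (forall g, UltraFilter (V g)) ->
  (forall g, size g = (size h + n)%N -> P g -> Q g) ->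
  allU V n h P -> allU V n h Q.
Proof.
move=> VU; elim: n h => [|n IH] h PQ /=; first by apply: PQ; rewrite addn0.
by apply: filterS => x; apply: IH => g; rewrite size_rcons addSnnS; exact: PQ.
Qed.

(** An ultrafilter contains a set or its complement, so failure of a property is itself generic. *)
Lemma not_allU V n h P : (forall g, UltraFilter (V g)) ->
  ~ allU V n h P -> allU V n h (fun g => ~ P g).
Proof.
move=> VU; elim: n h => [|n IH] h //= hP.
have [//|] := in_ultra_setVsetC [set x | allU V n (rcons h x) P] (VU h).
by apply: filterS => x; exact: IH.
Qed.

Lemma allU_shift V V' n h g P : (forall f, UltraFilter (V f)) ->
  (forall f, (size f < n)%N -> V (h ++ g ++ f) = V' (g ++ f)) ->
  allU V' n g (fun g' => P (h ++ g')) -> allU V n (h ++ g) P.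
Proof.
move=> VU; elim: n g => [|n IH] g //= VV'.
have := VV' [::] (ltn0Sn n); rewrite !cats0 => <-.
apply: filterS => x; rewrite rcons_cat; apply: IH => f fn.
by rewrite cat_rcons VV'.
Qed.

Definition norming (x : X) : X -> R := projT1 (cid (norming_functional x)).

Lemma contraction_norming x : contraction (norming x).
Proof. by rewrite /norming; case: cid => phi []. Qed.

Lemma norming_norm x : norming x x = `|x|.
Proof. by rewrite /norming; case: cid => phi []. Qed.

(* The iterated limit, over the completions [b'] of [b] along [W], of the
   functionals norming the sum of [b']. *)
Fixpoint lim_norming W n b : X -> R :=
  if n is n'.+1 then fun y => lim (lim_norming W n' (rcons b x) y @[x --> W b])
  else norming (\sum_(x <- b) x).

Lemma contraction_cvg (F : set_system X) (f : X -> X -> R) y :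
  UltraFilter F -> (forall x, contraction (f x)) ->
  f x y @[x --> F] --> lim (f x y @[x --> F]).
Proof.
move=> FU fc; have : cvg (f x y @[x --> F]); last by [].
by apply: (ultra_bounded_cvg (r := `|y|)) => x; exact: (fc x).2.
Qed.

Lemma contraction_lim (F : set_system X) (f : X -> X -> R) :
  UltraFilter F -> (forall x, contraction (f x)) ->
  contraction (fun y => lim (f x y @[x --> F])).
Proof.
move=> FU fc; split=> [a y z|y].
  apply/cvg_lim => //.
  under eq_fun do rewrite (fc _).1.
  by apply: cvgD; [apply: cvgM; first exact: cvg_cst|]; exact: contraction_cvg.
have h := cvgP _ (contraction_cvg (y := y) FU fc).
have fy x : - `|y| <= f x y <= `|y| by rewrite -ler_norml (fc x).2.
rewrite ler_norml; apply/andP; split.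
  by apply: limr_ge => //; apply: nearW => x; have /andP[] := fy x.
by apply: limr_le => //; apply: nearW => x; have /andP[] := fy x.
Qed.

Lemma contraction_lim_norming W n b : (forall g, UltraFilter (W g)) ->
  contraction (lim_norming W n b).
Proof.
move=> WU; elim: n b => [|n IH] b /=; first exact: contraction_norming.
by apply: contraction_lim => x; exact: IH.
Qed.

End IteratedUltrafilters.

(** * Generic sequences and separation by norming functionals *)

Section Generic.
Context {R : realType} {X : normedModType R}.
Implicit Types (V W : seq X -> set_system X) (h b : seq X) (B S T : seq nat).

Lemma generic_sequence V (inv : seq X -> Prop) :
  (forall h, ProperFilter (V h)) -> inv [::] ->
  (forall h, inv h -> \forall x \near V h, inv (rcons h x)) ->
  exists z : nat -> X, forall n, inv (mkseq z n).
Proof.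
move=> VP inv0 invS.
have /choice[g gP] : forall h, exists x, inv h -> inv (rcons h x).
  move=> h; have [ih|ih] := pselect (inv h); last by exists 0.
  by have [x ?] := filter_ex (invS h ih); exists x.
pose H := fix H n := if n is n'.+1 then rcons (H n') (g (H n')) else [::].
exists (g \o H) => n.
have -> : mkseq (g \o H) n = H n by elim: n => //= n IH; rewrite mkseqS IH.
by elim: n => //= n; exact: gP.
Qed.

Lemma contraction0 (phi : X -> R) : contraction phi -> phi 0 = 0.
Proof. by move=> [phiL _]; have := phiL 1 0 0; rewrite scale1r addr0 mul1r; lra. Qed.

Lemma contractionD (phi : X -> R) x y : contraction phi ->
  phi (x + y) = phi x + phi y.
Proof. by move=> [phiL _]; rewrite -[x in LHS]scale1r phiL mul1r. Qed.

Lemma contractionB (phi : X -> R) x y : contraction phi ->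
  phi (x - y) = phi x - phi y.
Proof. by move=> [phiL _]; rewrite addrC -scaleN1r phiL; lra. Qed.

Lemma contraction_sum (phi : X -> R) I (r : seq I) (P : pred I) (F : I -> X) :
  contraction phi -> phi (\sum_(i <- r | P i) F i) = \sum_(i <- r | P i) phi (F i).
Proof.
move=> c; apply: (big_morph phi) => [x y|]; [exact: contractionD|exact: contraction0].
Qed.

(** Tolerance at position [q]; the total stays below 1, which is the loss in [tracks_separates]. *)
Definition eps (q : nat) : R := 2^-1 ^+ q.+1.

Lemma eps_gt0 q : 0 < eps q.
Proof. by rewrite exprn_gt0// invr_gt0. Qed.

Lemma sum_eps N : \sum_(q <- iota 0 N) eps q < 1.
Proof.
suff -> : \sum_(q <- iota 0 N) eps q = 1 - 2^-1 ^+ N.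
  by rewrite ltrBlDr ltrDl exprn_gt0// invr_gt0.
elim: N => [|N IH]; first by rewrite big_nil expr0 subrr.
by rewrite -addn1 iotaD big_cat/= IH big_seq1 add0n /eps addn1 exprS; lra.
Qed.

Definition sel h B : seq X := [seq nth 0 h p | p <- B].

Lemma sel_rcons h x B : all (gtn (size h)) B -> sel (rcons h x) B = sel h B.
Proof. by move=> /allP Bh; apply/eq_in_map => p /Bh /= ph; rewrite nth_rcons ph. Qed.

(* Along the positions [B], the ultrafilters prescribed by [V] are those of the
   tree [W]. *)
Definition follows V W B := forall i, (i < size B)%N ->
  forall h, size h = nth 0%N B i -> V h = W (sel h (take i B)).

Lemma follows_rcons V W B N : follows V W (rcons B N) <->
  follows V W B /\ forall h, size h = N -> V h = W (sel h B).
Proof.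
split=> [f|[fB fN] i]; first split=> [i iB h sh|h sh].
- rewrite (f i) ?size_rcons 1?ltnW ?nth_rcons ?iB//.
  by rewrite -cats1 takel_cat// ltnW.
- rewrite (f (size B)) ?size_rcons ?nth_rcons ?ltnn ?eqxx//.
  by rewrite -cats1 take_size_cat.
- rewrite size_rcons ltnS leq_eqVlt nth_rcons -cats1 => /predU1P[->|iB] h.
    by rewrite ltnn eqxx take_size_cat//; exact: fN.
  by rewrite iB takel_cat ?(ltnW iB)//; exact: fB.
Qed.

(* [B] ranges over the increasing sequences of positions below [size h]. *)
Definition tracks V W k P h := forall m : bitseq, size m = size h ->
  let B := mask m (iota 0 (size h)) in
  follows V W B -> (size B <= k)%N ->
  allU W (k - size B) (sel h B) P /\
  forall q, (q < size h)%N -> q \notin B ->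
    `|lim_norming W (k - size B) (sel h B) (nth 0 h q)| < eps q.

Lemma mask_iota_lt m N : all (gtn N) (mask m (iota 0 N)).
Proof. by apply/allP => p /mem_mask; rewrite mem_iota. Qed.

Lemma tracks_rcons V W k P h :
  (forall g, weakly_null (V g)) -> (forall g, weakly_null (W g)) ->
  tracks V W k P h -> \forall x \near V h, tracks V W k P (rcons h x).
Proof.
move=> Vw Ww trh; have [VU _ Vker] := Vw h.
have WU g : UltraFilter (W g) by have [] := Ww g.
pose N := size h.
(* Coding the sequences [B] by masks leaves finitely many conditions on [x], which a filter can meet
   together. *)
suff H (m : N.+1.-tuple bool) : \forall x \near V h,
    let B := mask m (iota 0 N.+1) in
    follows V W B -> (size B <= k)%N ->
    allU W (k - size B) (sel (rcons h x) B) P /\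
    forall q, (q < N.+1)%N -> q \notin B ->
    `|lim_norming W (k - size B) (sel (rcons h x) B) (nth 0 (rcons h x) q)| < eps q.
  have FV : Filter (nbhs (V h)) by exact: (@ultra_proper _ (V h)).
  have HV := filter_forall FV H.
  apply: filterS HV => x Hx m.
  rewrite size_rcons => sm; exact: (Hx (Tuple (introT eqP sm))).
have -> : iota 0 N.+1 = rcons (iota 0 N) N by rewrite -addn1 iotaD cats1.
case: m => m /= /eqP; case/lastP: m => // m a; rewrite size_rcons => -[sm].
rewrite mask_rcons ?size_iota//.
have /= := trh m sm; rewrite -/N; set B := mask m (iota 0 N) => trB.
have BN : all (gtn N) B by exact: mask_iota_lt.
(* If the new position is off [B], the functional attached to [B] is unchanged and its kernel
   belongs to [V h]. *)
case: a => /=; last first.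
  rewrite cats0.
  have [fB|nfB] := pselect (follows V W B); last by apply: nearW => x /nfB.
  have [Bk|nBk] := leqP (size B) k; last by apply: nearW.
  have [aP small] := trB fB Bk.
  have := Vker _ (contraction_lim_norming (k - size B) (sel h B) WU).
  apply: filterS => x /= kerx _ _; rewrite sel_rcons//; split=> // q.
  rewrite ltnS leq_eqVlt nth_rcons => /predU1P[->|qN]; last by rewrite qN; exact: small.
  by rewrite ltnn eqxx kerx normr0 eps_gt0.
rewrite cats1 size_rcons.
have [fB|nfB] := pselect (follows V W (rcons B N)); last by apply: nearW => x /nfB.
have [Bk|nBk] := leqP (size B).+1 k; last by apply: nearW.
have [{}fB /(_ h erefl) Vh] := (follows_rcons _ _ _ _).1 fB.
have [aP small] := trB fB (ltnW Bk).
have kE : (k - size B = (k - (size B).+1).+1)%N by lia.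
move: aP small; rewrite kE; set n := (k - (size B).+1)%N => /= aP small.
have sE x : sel (rcons h x) (rcons B N) = rcons (sel h B) x.
  by rewrite /sel map_rcons -/(sel _ B) sel_rcons// nth_rcons ltnn eqxx.
(* If the new position extends [B], the old functional is the limit of the new ones along
   [W (sel h B)], so strict smallness at the earlier positions persists for almost every [x]. *)
have near_small : \forall x \near W (sel h B), forall q : 'I_N, val q \notin B ->
    `|lim_norming W n (rcons (sel h B) x) (nth 0 h q)| < eps q.
  apply: filter_forall => q; have [qB|qB] := boolP (val q \in B).
    by apply: nearW.
  have := small q (ltn_ord q) qB.
  have := contraction_cvg (y := nth 0 h q) (WU (sel h B))
    (fun x => contraction_lim_norming n (rcons (sel h B) x) WU).
  by move=> /cvgr_norm_lt cv /cv; apply: filterS.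
rewrite Vh; apply: filterS2 aP near_small => x aP small' _ _.
rewrite sE; split=> // q; rewrite ltnS leq_eqVlt mem_rcons inE => /predU1P[->|qN].
  by rewrite eqxx.
by rewrite (ltn_eqF qN)/= nth_rcons qN => qB; exact: (small' (Ordinal qN)).
Qed.

Lemma tracks_nil V W k P : allU W k [::] P -> tracks V W k P [::].
Proof. by move=> aP m /size0nil-> B _ _; rewrite /B /= subn0; split. Qed.

Lemma ler_sum_uniq (F : nat -> R) S N : (forall q, 0 <= F q) -> uniq S ->
  all (gtn N) S -> \sum_(q <- S) F q <= \sum_(q <- iota 0 N) F q.
Proof.
move=> F0 uS /allP SN.
rewrite [leRHS](bigID (mem S))/= -[leLHS]addr0 lerD ?sumr_ge0//.
rewrite -[leRHS]big_filter le_eqVlt; apply/orP; left; apply/eqP/perm_big.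
apply: uniq_perm => // [|q]; first by rewrite filter_uniq ?iota_uniq.
by rewrite mem_filter mem_iota add0n /=; case: (boolP (q \in S)) => // /SN.
Qed.

(** Once the branch is complete, its functional norms the sum over [B], which exceeds [C]. The other
    positions of [S] and [T] are distinct, so together they change the value by less than 1. *)
Lemma tracks_separates V W k C (z : nat -> X) B S T :
  (forall g, weakly_null (W g)) ->
  (forall N, tracks V W k (fun b => C < `|\sum_(x <- b) x|) (mkseq z N)) ->
  follows V W B -> size B = k -> sorted ltn B ->
  uniq S -> uniq T -> {subset B <= S} -> {in S, forall q, q \notin T} ->
  C - 1 < `|\sum_(q <- S) z q - \sum_(q <- T) z q|.
Proof.
move=> Ww trN fB sB Bs uS uT BS ST.
have [N SN TN] : exists2 N, all (gtn N) S & all (gtn N) T.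
  exists (\max_(p <- S) p + \max_(p <- T) p).+1; apply/allP => p pS /=.
    by have /= := leq_bigmax_seq (F := id) p pS isT; lia.
  by have /= := leq_bigmax_seq (F := id) p pS isT; lia.
have tr := trN N.
have WU g : UltraFilter (W g) by have [] := Ww g.
have uB : uniq B by exact: sorted_uniq ltn_trans ltnn _ Bs.
have BE : B = mask (map (mem B) (iota 0 N)) (iota 0 N).
  rewrite -filter_mask; apply: (irr_sorted_eq ltn_trans ltnn) => //.
    by apply: sorted_filter; [exact: ltn_trans|exact: iota_ltn_sorted].
  move=> q; rewrite mem_filter mem_iota add0n /=.
  by case: (boolP (q \in B)) => // /BS /(allP SN).
have := tr (map (mem B) (iota 0 N)); rewrite /= size_map size_iota size_mkseq -BE.
move=> /(_ erefl fB); rewrite sB subnn => /(_ (leqnn _)) [/= Csum small].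
have selE : sel (mkseq z N) B = map z B.
  by apply/eq_in_map => p /BS /(allP SN)/= pN; rewrite nth_mkseq.
move: Csum small; rewrite selE big_map => Csum small.
set phi := norming _ in small; have cphi : contraction phi by exact: contraction_norming.
have phiB : phi (\sum_(q <- B) z q) = `|\sum_(q <- B) z q|.
  exact: norming_norm.
have {}small q : (q < N)%N -> q \notin B -> `|phi (z q)| < eps q.
  by move=> qN; have := small q qN; rewrite nth_mkseq.
apply: lt_le_trans (cphi.2 _); apply: lt_le_trans (ler_norm _).
have SE : \sum_(q <- S) z q = \sum_(q <- B) z q + \sum_(q <- S | q \notin B) z q.
  rewrite (bigID (mem B))/= -big_filter; congr (_ + _); apply: perm_big.
  apply: uniq_perm => // [|q]; first exact: filter_uniq.
  by rewrite mem_filter; case: (boolP (q \in B)) => // /BS.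
rewrite contractionB// SE contractionD// phiB !(contraction_sum _ _ _ cphi).
have B_T q : q \in T -> q \notin B by move=> qT; apply/negP => /BS /ST; rewrite qT.
pose F q := if q \in B then 0 else eps q.
have F0 q : 0 <= F q by rewrite /F; case: ifP => // _; exact/ltW/eps_gt0.
have S1 : - \sum_(q <- S | q \notin B) phi (z q) <= \sum_(q <- S) F q.
  rewrite big_mkcond/= -sumrN big_seq [leRHS]big_seq ler_sum// => q qS; rewrite /F.
  have [_|qB] := boolP (q \in B); first by rewrite oppr0.
  rewrite /=; have := small q (allP SN q qS) qB; rewrite ltr_norml => /andP[+ _].
  by lra.
have T1 : \sum_(q <- T) phi (z q) <= \sum_(q <- T) F q.
  rewrite big_seq [leRHS]big_seq ler_sum// => q qT; rewrite /F (negbTE (B_T q qT)).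
  by have := small q (allP TN q qT) (B_T q qT); rewrite ltr_norml => /andP[_ +]; lra.
have ST1 : \sum_(q <- S) F q + \sum_(q <- T) F q < 1.
  apply: le_lt_trans (sum_eps N).
  rewrite -big_cat/= (le_trans (ler_sum_uniq (N := N) F0 _ _))//.
  - rewrite cat_uniq uS uT andbT; apply/hasPn => q qT /=.
    by apply/negP => /ST; rewrite qT.
  - by rewrite all_cat SN TN.
  - apply: ler_sum => q _; rewrite /F; case: ifP => // _; exact/ltW/eps_gt0.
lra.
Qed.

End Generic.

(** * Concentration and sums along a finite list of ultrafilters *)

Section HammingLipschitz.
Context {R : realType} {X : normedModType R}.

Definition HC_const (lam : R) :=
  0 < lam /\ forall (k : nat) (f : k.-tuple nat -> X) (L : R), is_Lip f L ->
    exists n m, [/\ incr_tuple n, incr_tuple m, tuple_disjoint n m &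
                    `|f n - f m| <= lam * L].

(** The infimum of the Lipschitz constants is itself one: for each pair at positive distance, divide
    by the distance and pass to the infimum. *)
Lemma lip_const_is_Lip k (f : k.-tuple nat -> X) L :
  lip_const f L -> exists2 L', is_Lip f L' & L' <= L.
Proof.
move=> fL; pose E := [set L | lip_const f L].
have E0 : E !=set0 by exists L.
have lE : has_lbound E by exists 0 => l [].
exists (inf E); last exact: ge_inf.
split=> [|L' fL']; last exact: ge_inf.
split=> [|n m ni mi]; first by apply: lb_le_inf => // l [].
have [h0|h0] := posnP (hamming n m).
  by have := fL.2 n m ni mi; rewrite h0 !mulr0.
rewrite -ler_pdivrMr ?ltr0n//; apply: lb_le_inf => // l [_ /(_ n m ni mi)].
by rewrite ler_pdivrMr ?ltr0n.
Qed.

Lemma HC_const_lip lam k (f : k.-tuple nat -> X) L : HC_const lam ->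
  lip_const f L -> exists n m, [/\ incr_tuple n, incr_tuple m,
    tuple_disjoint n m & `|f n - f m| <= lam * L].
Proof.
move=> [lam0 hc] /lip_const_is_Lip[L' fL' L'L].
have [n [m [ni mi nm fnm]]] := hc k f L' fL'; exists n, m; split => //.
by apply: le_trans fnm _; rewrite ler_pM2l.
Qed.

Lemma lip_const_sum k (Y : nat -> nat -> X) L : 0 <= L ->
  (forall j p q, `|Y j p - Y j q| <= L) ->
  lip_const (fun n : k.-tuple nat => \sum_(j < k) Y j (tnth n j)) L.
Proof.
move=> L0 YL; split=> // n m _ _; rewrite -sumrB.
apply: le_trans (ler_norm_sum _ _ _) _.
rewrite /hamming -sum1_card natr_sum mulr_sumr [leRHS]big_mkcond/=.
apply: ler_sum => j _; case: ifPn => [_|]; first by rewrite mulr1.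
by rewrite notin_setE/= => /negP; rewrite negbK => /eqP->; rewrite subrr normr0.
Qed.

(* If the bound failed, spreading copies of [U 0, ..., U r.-1] periodically
   would give a sequence [z] for which [n |-> sum_j z (n_j * r + j)] violates
   the concentration property. *)
Lemma allU_sum_bound lam (U : nat -> set_system X) r : HC_const lam ->
  (forall i, weakly_null (U i)) ->
  allU (fun h => U (size h)) r [::] (fun h => `|\sum_(x <- h) x| <= 2 * lam + 1).
Proof.
move=> hc Uw; have lam0 := hc.1.
have [->|r0] := posnP r; first by rewrite /= big_nil normr0; lra.
pose W (h : seq X) := U (size h); pose V (h : seq X) := U (size h %% r)%N.
have Ww h : weakly_null (W h) by exact: Uw.
have Vw h : weakly_null (V h) by exact: Uw.
have VU h : UltraFilter (V h) by have [] := Vw h.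
have WU h : UltraFilter (W h) by have [] := Ww h.
(* Separation loses 1 and leaves [2 * lam], which is what concentration allows for the Lipschitz
   constant 2. *)
pose P (b : seq X) : Prop := 2 * lam + 1 < `|\sum_(x <- b) x|.
apply: contrapT => /(not_allU WU) nb.
have {nb} aP : allU W r [::] P.
  by apply: sub_allU nb => // g _ /negP; rewrite -ltNge.
pose inv h := tracks V W r P h /\ all (fun x : X => `|x| <= 1) h.
have inv0 : inv [::] by split=> //; exact: tracks_nil.
have invS h : inv h -> \forall x \near V h, inv (rcons h x).
  move=> [trh h1]; have [_ ball1 _] := Vw h.
  apply: filterS2 (tracks_rcons Vw Ww trh) ball1 => x trx x1.
  by split=> //; rewrite all_rcons h1 andbT.
have [z zinv] := generic_sequence (fun h => @ultra_proper _ _ (VU h)) inv0 invS.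
have z1 i : `|z i| <= 1.
  by have [_] := zinv i.+1; rewrite mkseqS all_rcons => /andP[].
pose f (n : r.-tuple nat) := \sum_(j < r) z (tnth n j * r + j)%N.
have flip : lip_const f 2.
  apply: (@lip_const_sum r (fun j p => z (p * r + j)%N)); first by lra.
  move=> j p q; apply: le_trans (ler_normB _ _) _.
  by have := z1 (p * r + j)%N; have := z1 (q * r + j)%N; lra.
have [n [m [ni mi nm]]] := HC_const_lip hc flip.
(* The [j]-th position has residue [j] modulo [r], so the periodic [V] uses [U j] there. *)
pose pos (n : r.-tuple nat) := [seq (nth 0 n j * r + j)%N | j <- iota 0 r].
have fE t : f t = \sum_(p <- pos t) z p.
  have := big_mkord xpredT (fun j => z (nth 0 t j * r + j)%N)
    (n := r) (op := +%R) (idx := 0).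
  rewrite /index_iota subn0 big_map => ->.
  by apply: eq_bigr => j _; rewrite (tnth_nth 0%N).
have sz_pos t : size (pos t) = r by rewrite size_map size_iota.
have nth_pos t i : (i < r)%N -> nth 0%N (pos t) i = (nth 0 t i * r + i)%N.
  by move=> ir; rewrite (nth_map 0%N) ?size_iota// nth_iota.
have pos_sorted t : incr_tuple t -> sorted ltn (pos t).
  move=> /(sortedP 0%N); rewrite size_tuple => ti.
  apply/(sortedP 0%N) => i; rewrite sz_pos => ir.
  by rewrite !nth_pos//; [have := ti i ir; nia|lia].
have fol : follows V W (pos n).
  move=> i; rewrite sz_pos => ir h; rewrite nth_pos// => sh.
  rewrite /V /W sh modnMDl modn_small// size_map size_takel// sz_pos.
  exact: ltnW.
have disj : {in pos n, forall q, q \notin pos m}.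
  move=> q /mapP[i]; rewrite mem_iota add0n => /= ir ->.
  apply/negP => /mapP[j]; rewrite mem_iota add0n => /= jr e.
  (* Equal positions have equal residues, so only entries with the same index need to differ. *)
  have ij : i = j by have := congr1 (modn^~ r) e; rewrite /= !modnMDl !modn_small.
  move: e; rewrite -ij => /addIn/eqP; rewrite eqn_pmul2r//.
  have := nm (Ordinal ir) (Ordinal ir); rewrite !(tnth_nth 0%N) /=.
  by move=> /negbTE->.
have psu t : incr_tuple t -> uniq (pos t).
  by move=> /pos_sorted; exact: sorted_uniq ltn_trans ltnn _.
have := tracks_separates Ww (fun N : nat => (zinv N).1) fol (sz_pos n) (pos_sorted _ ni)
  (psu _ ni) (psu _ mi)
  (fun q h => h) disj.
by rewrite -!fE; lra.
Qed.

End HammingLipschitz.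

(** * A tree on the natural numbers from binary expansions *)

Fixpoint branch_rec f p : seq nat :=
  if f is f'.+1 then
    if p is 0 then [::] else rcons (branch_rec f' (p - 2 ^ trunc_log 2 p)%N) p
  else [::].

(* Positions [2 ^ q + s] with [s < 2 ^ q] form level [q] of a tree in which the
   parent of [2 ^ q + s] is [s]; [branch p] lists the path from the root to [p].
   Every node is thus the parent of one node on each later level. *)
Definition branch p := branch_rec p p.

(** The first argument of [branch_rec] is fuel. Removing the leading binary digit lowers a positive
    number, so fuel [p] suffices. *)
Lemma branch_recE f p : (p <= f)%N -> branch_rec f p = branch p.
Proof.
rewrite /branch => pf.
suff H g h r : (r <= g)%N -> (r <= h)%N -> branch_rec g r = branch_rec h r by exact: H.
elim: g h r => [|g IH] [|h] [|r] //= rg rh; congr rcons.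
have : (0 < 2 ^ trunc_log 2 r.+1)%N by rewrite expn_gt0.
by move=> ?; apply: IH; lia.
Qed.

Lemma trunc_log_level q s : (s < 2 ^ q)%N -> trunc_log 2 (2 ^ q + s) = q.
Proof. by move=> sq; apply: trunc_log_eq => //; rewrite expnS; lia. Qed.

Lemma branch_level q s : (s < 2 ^ q)%N ->
  branch (2 ^ q + s) = rcons (branch s) (2 ^ q + s)%N.
Proof.
move=> sq; have : (0 < 2 ^ q)%N by rewrite expn_gt0.
rewrite /branch; case e : (2 ^ q + s)%N => [|p]; first by lia.
by move=> q0; rewrite /= -e trunc_log_level// addKn branch_recE//; lia.
Qed.

Lemma branch_le p x : x \in branch p -> (x <= p)%N.
Proof.
elim/ltn_ind: p => -[//|p] IH; have : (0 < 2 ^ trunc_log 2 p.+1)%N by rewrite expn_gt0.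
move=> e0; rewrite /branch /= branch_recE; last by lia.
by rewrite mem_rcons inE => /predU1P[->//|/IH]; lia.
Qed.

Definition level q := iota (2 ^ q) (2 ^ q).

Lemma mem_level q p : p \in level q -> trunc_log 2 p = q.
Proof. by rewrite mem_iota => pq; apply: trunc_log_eq => //; rewrite expnS; lia. Qed.

Lemma uniq_levels (n : seq nat) : uniq n -> uniq (flatten (map level n)).
Proof.
elim: n => //= q n IH /andP[qn /IH un]; rewrite cat_uniq iota_uniq un andbT /=.
apply/hasPn => p /flatten_mapP[q' q'n /mem_level pq'].
by apply/negP => /mem_level pq; move: qn; rewrite -pq pq' q'n.
Qed.

(** For increasing [n], the end of the branch that has exactly one node on each level listed in
    [n]. *)
Definition node (n : seq nat) := (\sum_(q <- n) 2 ^ q)%N.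

Lemma node_rcons n q : node (rcons n q) = (2 ^ q + node n)%N.
Proof. by rewrite /node -cats1 big_cat big_seq1 addnC. Qed.

Lemma node_lt n q : sorted ltn n -> all (gtn q) n -> (node n < 2 ^ q)%N.
Proof.
elim/last_ind: n q => [|n p IH] q; first by rewrite /node big_nil expn_gt0.
rewrite sorted_pairwise ?pairwise_rcons; last exact: ltn_trans.
rewrite all_rcons -sorted_pairwise; last exact: ltn_trans.
move=> /andP[np sn] /andP[pq _]; rewrite node_rcons.
have := IH p sn np; have : (2 ^ p.+1 <= 2 ^ q)%N by rewrite leq_exp2l.
by rewrite expnS; lia.
Qed.

(** * Sums over levels and along branches *)

Section Tree.
Context {R : realType} {X : normedModType R}.
Implicit Types (W : seq X -> set_system X) (h b : seq X).

(** The next position, [size h], is filled as a child in [W] of the terms on the path to its parent.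
    Position 0 stands for the root: its path is empty, and its term lies on no level. *)
Definition tree W h :=
  W (sel h (branch (size h - 2 ^ trunc_log 2 (size h))%N)).

(** A further level [q] prolongs the branch by the child of its end on that level; [node_lt] ensures
    that this child exists. *)
Lemma branch_node W (n : seq nat) : sorted ltn n ->
  [/\ sorted ltn (branch (node n)), size (branch (node n)) = size n,
      {subset branch (node n) <= flatten (map level n)} &
      follows (tree W) W (branch (node n))].
Proof.
elim/last_ind: n => [|n q IH]; first by rewrite /node big_nil; split=> // ? .
rewrite sorted_pairwise ?pairwise_rcons; last exact: ltn_trans.
rewrite -sorted_pairwise; last exact: ltn_trans.
move=> /andP[nq sn]; have [sB szB subB folB] := IH sn.
have lt := node_lt sn nq.
rewrite node_rcons branch_level//; split.
- rewrite sorted_pairwise ?pairwise_rcons; last exact: ltn_trans.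
  rewrite -sorted_pairwise ?sB ?andbT; last exact: ltn_trans.
  by apply/allP => p /branch_le /=; lia.
- by rewrite !size_rcons szB.
- move=> p; rewrite map_rcons flatten_rcons mem_cat mem_rcons inE.
  move=> /predU1P[->|/subB->//]; apply/orP; right.
  by rewrite mem_iota; lia.
- apply/follows_rcons; split=> // h sh.
  by rewrite /tree sh trunc_log_level// addKn.
Qed.

Lemma sel_cat h g B : all (gtn (size h)) B -> sel (h ++ g) B = sel h B.
Proof. by move=> /allP Bh; apply/eq_in_map => p /Bh /= ph; rewrite nth_cat ph. Qed.

(** The parents of the nodes on level [q] all lie below [2 ^ q], so [h] already determines every
    ultrafilter used on the level. They form a fixed finite list, to which [allU_sum_bound]
    applies. *)
Lemma allU_level lam W q h : @HC_const R X lam -> (forall g, weakly_null (W g)) ->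
  size h = (2 ^ q)%N -> allU (tree W) (2 ^ q) h
    (fun g => `|\sum_(p <- level q) nth 0 g p| <= 2 * lam + 1).
Proof.
move=> hc Ww sh.
have WU g : UltraFilter (W g) by have [] := Ww g.
rewrite -[h in allU _ _ h _]cats0.
apply: (@allU_shift _ _ _ (fun g => W (sel h (branch (size g))))) => [g gq|].
  rewrite /tree size_cat sh trunc_log_level// addKn sel_cat//.
  by apply/allP => p /branch_le /=; lia.
have := @allU_sum_bound _ _ lam (fun i => W (sel h (branch i))) (2 ^ q) hc
  (fun i => Ww _).
apply: sub_allU => g /= sg.
suff -> : \sum_(p <- level q) nth 0 (h ++ g) p = \sum_(x <- g) x by [].
rewrite /level -[X in iota X _]addn0 iotaDl big_map [RHS](big_nth 0) sg add0n.
rewrite /index_iota subn0; apply: eq_bigr => i _.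
by rewrite nth_cat sh ltnNge leq_addr /= addKn.
Qed.

(** A level in progress carries a generic promise about its completion. For a complete level the
    truncated subtraction gives 0, and the promise becomes the bound itself. *)
Definition levels_bounded W c h := forall q, (2 ^ q <= size h)%N ->
  allU (tree W) (2 ^ q.+1 - size h) h
    (fun g => `|\sum_(p <- level q) nth 0 g p| <= c).

(** Only the level in progress restricts [x]: a level that opens next is covered by [allU_level],
    and the sum over a complete one no longer changes. *)
Lemma levels_bounded_rcons lam W h : @HC_const R X lam ->
  (forall g, weakly_null (W g)) -> levels_bounded W (2 * lam + 1) h ->
  \forall x \near tree W h, levels_bounded W (2 * lam + 1) (rcons h x).
Proof.
move=> hc Ww hb; set c := 2 * lam + 1 in hb *.
have Tw g : weakly_null (tree W g) by exact: Ww.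
have TU g : UltraFilter (tree W g) by have [] := Tw g.
have FT : Filter (nbhs (tree W h)) by exact: (@ultra_proper _ (tree W h)).
pose P q (g : seq X) := `|\sum_(p <- level q) nth 0 g p| <= c.
pose q0 := trunc_log 2 (size h).
have : \forall x \near tree W h, (0 < size h)%N ->
    allU (tree W) (2 ^ q0.+1 - (size h).+1) (rcons h x) (P q0).
  have [h0|h0] := posnP (size h); first by apply: nearW.
  have := hb q0 (trunc_logP (ltnSn 1) h0).
  have := trunc_log_ltn (size h) (ltnSn 1); rewrite -/q0 => hq0.
  have -> : (2 ^ q0.+1 - size h = (2 ^ q0.+1 - (size h).+1).+1)%N by lia.
  rewrite [allU _ _.+1 _ _]/=.
  by apply: filterS => x hx _.
apply: filterS => x hx q; rewrite size_rcons leq_eqVlt ltnS => /predU1P[qh|qh].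
  rewrite -qh expnS mul2n -addnn addnK.
  by apply: allU_level => //; rewrite size_rcons.
have q20 : (0 < 2 ^ q)%N by rewrite expn_gt0.
have [hq|hq] := ltnP (size h) (2 ^ q.+1).
  have e : q0 = q by apply: trunc_log_eq => //; lia.
  by rewrite -e; apply: hx; lia.
have := hb q qh; have -> : (2 ^ q.+1 - size h = 0)%N by lia.
have -> : (2 ^ q.+1 - (size h).+1 = 0)%N by lia.
rewrite /=; congr (`|_| <= _); rewrite big_seq [RHS]big_seq.
apply: eq_bigr => p; rewrite mem_iota nth_rcons => pq.
by have -> : (p < size h)%N by move: hq; rewrite expnS; lia.
Qed.

(* Otherwise [n |-> sum_j Y n_j], with [Y q] the sum of a generic sequence over
   level [q], violates the concentration property: it is Lipschitz because
   [Y q] is bounded, and every [n] carries a whole branch of the tree. *)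
Lemma allU_tree_bound lam W k : @HC_const R X lam ->
  (forall g, weakly_null (W g)) ->
  allU W k [::] (fun b => `|\sum_(x <- b) x| <= 2 * lam * (2 * lam + 1) + 1).
Proof.
move=> hc Ww; have lam0 := hc.1; set c := 2 * lam + 1.
have WU h : UltraFilter (W h) by have [] := Ww h.
have Tw h : weakly_null (tree W h) by exact: Ww.
have TU h : UltraFilter (tree W h) by have [] := Tw h.
(* Separation leaves [lam * (2 * c)], where [2 * c] is the Lipschitz constant of [f] below. *)
pose P (b : seq X) : Prop := 2 * lam * c + 1 < `|\sum_(x <- b) x|.
apply: contrapT => /(not_allU WU) nb.
have {nb} aP : allU W k [::] P.
  by apply: sub_allU nb => // g _ /negP; rewrite -ltNge.
pose inv h := tracks (tree W) W k P h /\ levels_bounded W c h.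
have inv0 : inv [::].
  split=> [|q]; first exact: tracks_nil.
  by rewrite leqNgt expn_gt0.
have invS h : inv h -> \forall x \near tree W h, inv (rcons h x).
  move=> [trh hb].
  by apply: filterS2 (tracks_rcons Tw Ww trh) (levels_bounded_rcons hc Ww hb).
have [z zinv] := generic_sequence (fun h => @ultra_proper _ _ (TU h)) inv0 invS.
pose Y q := \sum_(p <- level q) z p.
have Yc q : `|Y q| <= c.
  have := (zinv (2 ^ q.+1)%N).2 q; rewrite size_mkseq subnn leq_exp2l// leqnSn.
  move=> /(_ isT) /=; congr (`|_| <= _); rewrite big_seq [RHS]big_seq.
  apply: eq_bigr => p; rewrite mem_iota => pq.
  by rewrite nth_mkseq// expnS; lia.
pose f (n : k.-tuple nat) := \sum_(j < k) Y (tnth n j).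
have flip : lip_const f (2 * c).
  apply: (@lip_const_sum _ _ k (fun _ => Y)); first by rewrite /c; lra.
  move=> _ p q; apply: le_trans (ler_normB _ _) _.
  by have := Yc p; have := Yc q; lra.
have [n [m [ni mi nm]]] := HC_const_lip hc flip.
(* Disjoint tuples select disjoint sets of positions, and [S n] contains the branch ending at
   [node n]. *)
pose S (t : k.-tuple nat) := flatten (map level t).
have fE t : f t = \sum_(p <- S t) z p.
  by rewrite big_flatten big_map big_tuple.
have Su t : incr_tuple t -> uniq (S t).
  by move=> ti; apply/uniq_levels/(sorted_uniq ltn_trans ltnn).
have disj : {in S n, forall q, q \notin S m}.
  move=> p /flatten_mapP[q /tnthP[i ->] /mem_level pq].
  apply/negP => /flatten_mapP[q' /tnthP[j ->] /mem_level pq'].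
  by have := nm i j; rewrite -pq -pq' eqxx.
have [sB szB BS fol] := branch_node W ni.
have := tracks_separates Ww (fun N : nat => (zinv N).1) fol
  (etrans szB (size_tuple n)) sB (Su _ ni) (Su _ mi) BS disj.
by rewrite -!fE; lra.
Qed.

End Tree.

(** * From trees of ultrafilters to the asymptotic game *)

Section Game.
Context {R : realType} {X : normedModType R}.
Implicit Types (xs : seq X) (P Q : seq X -> Prop).

Lemma contraction_continuous (phi : X -> R) : contraction phi -> continuous phi.
Proof.
move=> cphi x; apply/cvgrPdist_lt => e e0; near=> y.
rewrite -contractionB//; apply: le_lt_trans (cphi.2 _) _.
by near: y; exact: (cvgr_dist_lt id x cvg_id e e0).
Unshelve. all: by end_near. Qed.

Definition dual := {phi : X -> R | contraction phi}.

Fixpoint ker (Phi : seq dual) : set X :=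
  if Phi is phi :: Phi' then [set x | sval phi x = 0] `&` ker Phi' else setT.

Lemma ker_cat Phi Psi : ker (Phi ++ Psi) = ker Phi `&` ker Psi.
Proof. by elim: Phi => [|phi Phi IH] /=; rewrite ?setTI// IH setIA. Qed.

Lemma ker_subspace Phi : lin_subspace (ker Phi).
Proof.
elim: Phi => [|[phi c] Phi [K0 [KD KZ]]] //=; split; [|split] => /=.
- by split=> //; exact: contraction0.
- move=> x y [px Kx] [py Ky]; split; last exact: KD.
  by rewrite contractionD// px py addr0.
- move=> a x [px Kx]; split; last exact: KZ.
  by rewrite -[a *: x]addr0 c.1 px (contraction0 c) mulr0 addr0.
Qed.

Lemma ker_closed Phi : closed (ker Phi).
Proof.
elim: Phi => [|[phi c] Phi IH] /=; first exact: closedT.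
apply: closedI => //; apply: (@preimage_closed _ _ phi [set 0]).
  by move=> x _; exact: contraction_continuous.
exact: closed_eq.
Qed.

(** A functional that is nonzero at some [v] in [ker Phi] costs the one extra spanning vector [v]; a
    functional vanishing on [ker Phi] costs none. *)
Lemma ker_fin_codim Phi : fin_codim (ker Phi).
Proof.
elim: Phi => [|[phi c] Phi [s sP]] /=.
  by exists [::] => x; exists x, (fun=> 0); rewrite big_ord0 addr0.
have [[v Kv v0]|nv] := pselect (exists2 v, ker Phi v & phi v <> 0); last first.
  exists s => x; have [y [a [Ky xE]]] := sP x; exists y, a; split=> //; split=> //.
  by apply: contrapT => py; apply: nv; exists y.
exists (v :: s) => x; have [y [a [Ky xE]]] := sP x.
pose t := phi y / phi v.
exists (y + (- t) *: v), (fun i => oapp a t (unlift ord0 i)).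
have [_ [KD KZ]] := ker_subspace Phi.
split.
  split; last by apply: KD => //; exact: KZ.
  rewrite /= addrC c.1 /t mulNr divfK ?addNr//; exact/eqP.
rewrite big_ord_recl /= unlift_none /= addrA scaleNr subrK {1}xE.
by congr (_ + _); apply: eq_bigr => i _; rewrite liftK.
Qed.

Lemma ker_closed_fincodim Phi : closed_fincodim_subspace (ker Phi).
Proof.
split; [exact: ker_subspace|exact: ker_closed|exact: ker_fin_codim].
Qed.

(** Moves are restricted to finite intersections of kernels, so that several moves combine by
    concatenation. *)
Fixpoint ker_game P n xs : Prop :=
  if n is n'.+1 then exists Phi, forall x, ker Phi x -> `|x| = 1 ->
    ker_game P n' (rcons xs x)
  else P xs.

Lemma ker_game_asym C P n xs :
  (forall ys, size ys = (size xs + n)%N -> P ys -> asym_c0_game C 0 ys) ->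
  ker_game P n xs -> asym_c0_game C n xs.
Proof.
elim: n xs => [|n IH] xs Pasym; first by apply: Pasym; rewrite addn0.
move=> [Phi win]; exists (ker Phi); split; first exact: ker_closed_fincodim.
move=> x Kx x1; apply: IH (win x Kx x1) => ys.
by rewrite size_rcons addSnnS; exact: Pasym.
Qed.

(** Playing the concatenation of the winning moves for all [i] keeps every one of the games won. *)
Lemma ker_game_forall (I : finType) (Q : I -> seq X -> Prop) n xs :
  (forall i, ker_game (Q i) n xs) -> ker_game (fun ys => forall i, Q i ys) n xs.
Proof.
elim: n xs => [//|n IH] xs /= /choice[Phi win].
exists (flatten (map Phi (enum I))) => x Kx x1; apply: IH => i; apply: win => //.
have : i \in enum I by rewrite mem_enum.
elim: (enum I) Kx => //= j s IHs; rewrite ker_cat inE => -[Kj Ks] /predU1P[->//|].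
exact: IHs.
Qed.

Definition flip (e : nat -> bool) xs :=
  mkseq (fun i => (-1) ^+ e i *: nth 0 xs i) (size xs).

Lemma flip_rcons e xs x :
  flip e (rcons xs x) = rcons (flip e xs) ((-1) ^+ e (size xs) *: x).
Proof.
rewrite /flip size_rcons mkseqS nth_rcons ltnn eqxx; congr rcons.
by apply/eq_in_map => i; rewrite mem_iota => /andP[_ ix]; rewrite nth_rcons ix.
Qed.

(** Kernels and the unit sphere are symmetric, so the first player can follow the strategy for the
    history with flipped signs. *)
Lemma ker_game_flip P e n xs :
  ker_game P n (flip e xs) -> ker_game (P \o flip e) n xs.
Proof.
elim: n xs => [//|n IH] xs /= [Phi win]; exists Phi => x Kx x1.
apply: IH; rewrite flip_rcons; apply: win.
  by have [_ [_ KZ]] := ker_subspace Phi; exact: KZ.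
by rewrite normrZ normrX normrN1 expr1n mul1r.
Qed.

Lemma weakly_null0 : weakly_null (principal_filter (0 : X)).
Proof.
split; first exact: principal_filter_ultra.
  by apply/principal_filterP; rewrite /= normr0.
by move=> phi c; apply/principal_filterP; exact: contraction0.
Qed.

(** The admissible answers to the moves [Phi] form a filter base, since concatenating two moves
    refines both; any ultrafilter above it works. *)
Lemma losing_weakly_null (A : set X) :
  (forall Phi, exists x, [/\ ker Phi x, `|x| = 1 & A x]) ->
  exists F, weakly_null F /\ F A.
Proof.
move=> lose.
pose B (Phi : seq dual) := [set x | [/\ ker Phi x, `|x| = 1 & A x]].
have FP : ProperFilter (filter_from setT B).
  apply: filter_from_proper; last by move=> Phi _; exact: lose.
  apply: filter_from_filter; first by exists [::].
  move=> Phi Psi _ _; exists (Phi ++ Psi) => // x.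
  by rewrite /B /= ker_cat => -[[Kx Lx] x1 Ax].
have [F [FU sF]] := ultraFilterLemma FP.
exists F; split; last by apply: sF; exists [::] => // x [].
split=> //.
  by apply: sF; exists [::] => // x [_ /= -> _].
by move=> phi c; apply: sF; exists [:: exist _ phi c] => // x [[]].
Qed.

Lemma not_ker_game P k : ~ ker_game P k [::] ->
  exists W, (forall h, weakly_null (W h)) /\ allU W k [::] (fun xs => ~ P xs).
Proof.
move=> lose.
(* At a lost position the ultrafilter concentrates on answers after which the position is still
   lost; elsewhere the default is the principal ultrafilter at 0. *)
have /choice[W WP] : forall h, exists F, weakly_null F /\
    ((size h < k)%N -> ~ ker_game P (k - size h) h ->
     F [set x | ~ ker_game P (k - (size h).+1) (rcons h x)]).
  move=> h; have [[hk lh]|nh] := pselect ((size h < k)%N /\ ~ ker_game P (k - size h) h).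
    have [|F [Fw FA]] := @losing_weakly_null
      [set x | ~ ker_game P (k - (size h).+1) (rcons h x)]; last by exists F.
    move=> Phi; apply: contrapT => nx; apply: lh.
    have -> : (k - size h = (k - (size h).+1).+1)%N by lia.
    exists Phi => x Kx x1; apply: contrapT => lx; apply: nx.
    by exists x.
  exists (principal_filter 0); split; first exact: weakly_null0.
  by move=> hk lh; case: nh.
have WU h : UltraFilter (W h) by have [[]] := WP h.
exists W; split=> [h|]; first by have [] := WP h.
suff H n h : (size h + n)%N = k -> ~ ker_game P n h -> allU W n h (fun xs => ~ P xs).
  exact: H.
elim: n h => [//|n IH] h hn lh.
have := (WP h).2; have -> : (k - size h = n.+1)%N by lia.
have -> : (k - (size h).+1 = n)%N by lia.
have hk : (size h < k)%N by lia.
move=> /(_ hk lh); rewrite [allU _ _.+1 _ _]/=; apply: filterS => x; apply: IH.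
by rewrite size_rcons addSnnS.
Qed.

Lemma allU_contra W n h P : (forall g, UltraFilter (W g)) ->
  allU W n h P -> allU W n h (fun xs => ~ P xs) -> False.
Proof.
move=> WU; elim: n h => [//|n IH] h /= hP hN.
have FW : ProperFilter (nbhs (W h)) by exact: (@ultra_proper _ (W h)).
by have [x []] := filter_ex (filterI hP hN); exact: IH.
Qed.

(** Each coefficient in [[-1, 1]] is a convex combination of the two signs. They are treated one at
    a time, with [y] absorbing the terms already treated. *)
Lemma flip_bound_scale C n (x : nat -> X) (a : nat -> R) y :
  (forall e : nat -> bool, `|y + \sum_(i < n) (-1) ^+ e i *: x i| <= C) ->
  (forall i, (i < n)%N -> `|a i| <= 1) ->
  `|y + \sum_(i < n) a i *: x i| <= C.
Proof.
elim: n y => [|n IH] y eC a1; first by have := eC (fun=> false); rewrite !big_ord0.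
rewrite big_ord_recr /= addrA addrAC; apply: IH => [e|i ni]; last first.
  by apply: a1; exact: ltnW.
set w := \sum_(i < n) _.
have ew (b : bool) : `|y + w + (-1) ^+ b *: x n| <= C.
  have := eC (fun i => if i == n then b else e i).
  rewrite big_ord_recr /= eqxx addrA; congr (`|_ + _ + _| <= _).
  by apply: eq_bigr => i _; rewrite (ltn_eqF (ltn_ord i)).
have := ew true; have := ew false; rewrite expr0 expr1 scale1r scaleN1r => h1 h2.
have := a1 n (leqnn _); rewrite ler_norml => /andP[am ap].
have -> : y + a n *: x n + w =
    ((1 + a n) / 2) *: (y + w + x n) + ((1 - a n) / 2) *: (y + w - x n).
  rewrite [_ *: (_ + x n)]scalerDr [_ *: (_ - x n)]scalerDr addrACA -scalerDl.
  rewrite scalerN -scalerBl addrAC.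
  have -> : (1 + a n) / 2 + (1 - a n) / 2 = 1 by field.
  have -> : (1 + a n) / 2 - (1 - a n) / 2 = a n by field.
  by rewrite scale1r.
apply: le_trans (ler_normD _ _) _; rewrite !normrZ !ger0_norm; try lra.
have -> : C = (1 + a n) / 2 * C + (1 - a n) / 2 * C by field.
by apply: lerD; apply: ler_wpM2l => //; lra.
Qed.

Lemma flip_bound_asym C k xs : 0 <= C -> size xs = k ->
  (forall e : k.-tuple bool, `|\sum_(x <- flip (nth false e) xs) x| <= C) ->
  asym_c0_game C 0 xs.
Proof.
move=> C0 sx eC a /=.
set M := \big[Num.max/0]_(i < size xs) `|a i|.
have aM i : `|a i| <= M by exact: le_bigmax.
have M0 : 0 <= M by exact: bigmax_ge_id.
have [M00|Mn0] := eqVneq M 0.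
  rewrite big1 ?normr0 ?mulr_ge0// => i _.
  by have := aM i; rewrite M00 normr_le0 => /eqP->; rewrite scale0r.
have Mp : 0 < M by rewrite lt_neqAle eq_sym Mn0.
(* Dividing by the maximum brings the coefficients into [[-1, 1]]; indices out of range get 0. *)
pose a' i := oapp a 0 (insub i) / M.
have aE (i : 'I_(size xs)) : a i = M * a' i.
  by rewrite /a' valK /= mulrC divfK.
under eq_bigr do rewrite aE -scalerA.
rewrite -scaler_sumr normrZ ger0_norm// mulrC ler_wpM2r//.
have := @flip_bound_scale C (size xs) (nth 0 xs) a' 0; rewrite add0r; apply.
  move=> e; rewrite add0r.
  have := eC (Tuple (introT eqP (size_mkseq e k))); rewrite /flip big_map.
  have := big_mkord xpredT (fun i => (-1) ^+ nth false (mkseq e k) i *: xs`_i)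
    (n := size xs) (op := +%R) (idx := 0).
  rewrite /index_iota subn0 => -> /=; congr (`|_| <= _).
  by apply: eq_bigr => i _; rewrite nth_mkseq// -sx.
move=> i ix; have e := aE (Ordinal ix); have := aM (Ordinal ix).
by rewrite e normrM ger0_norm// -[leRHS]mulr1 ler_pM2l.
Qed.

(** Losing the game for the plain sum would give a tree contradicting [allU_tree_bound]. A win
    transfers to every sign pattern, then to all patterns at once. *)
Lemma HC_const_asym lam k : @HC_const R X lam ->
  asym_c0_game (X := X) (2 * lam * (2 * lam + 1) + 1) k [::].
Proof.
move=> hc; have lam0 := hc.1; set C := _ + 1.
have C0 : 0 <= C by rewrite /C; nra.
have win : ker_game (fun xs => `|\sum_(x <- xs) x| <= C) k [::].
  apply: contrapT => /not_ker_game[W [Ww]].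
  apply: (allU_contra _ (allU_tree_bound k hc Ww)) => g.
  by have [] := Ww g.
have {}win (e : k.-tuple bool) := @ker_game_flip _ (nth false e) k [::] win.
by apply: ker_game_asym (ker_game_forall win) => ys sy; exact: flip_bound_asym.
Qed.

End Game.

Theorem theorem4 (R : realType) (X : completeNormedModType R) :
  separable X -> @HC_infty R X -> @asymptotic_c0 R X.
Proof.
move=> _ [lam hc]; have lam0 : 0 < lam := hc.1.
exists (2 * lam * (2 * lam + 1) + 1); split; first by nra.
by move=> k; exact: HC_const_asym.
Qed.
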